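(* If $0<c<c^*$, then the system $$\begin{cases}\displaystyle\rho(\xi+c)=\int_{\mathbb R}\frac{(1+d_1)\rho(\xi-y)}{1+d_1\big(\rho(\xi-y)+b_1\rho(\xi-y-c)+a_1\varrho(\xi-y)\big)}k_1(y)\,dy,\\[2mm] \displaystyle\varrho(\xi+c)=\int_{\mathbb R}\frac{(1+d_2)\varrho(\xi-y)}{1+d_2\big(\varrho(\xi-y)+b_2\varrho(\xi-y-c)+a_2\rho(\xi-y)\big)}k_2(y)\,dy,\end{cases}\qquad \xi\in\mathbb R,$$ does not have positive solutions $(\rho,\varrho)$ satisfying $$\lim_{\xi\to-\infty}\rho(\xi)=\lim_{\xi\to-\infty}\varrho(\xi)=0,\qquad \liminf_{\xi\to+\infty}\rho(\xi)>0,\qquad \liminf_{\xi\to+\infty}\varrho(\xi)>0.$$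
   Context: Solutions are bounded uniformly continuous functions $\mathbb R\to\mathbb R^2$ (wave profiles), and wave speeds $c$ are positive. All parameters $a_1,a_2,b_1,b_2,d_1,d_2$ are nonnegative, and $d_1>0$, $d_2>0$, $1+b_1>a_2$, $1+b_2>a_1$. For $i=1,2$, the kernel $k_i:\mathbb R\to[0,\infty)$ is Lebesgue measurable and integrable, even ($k_i(x)=k_i(-x)$), with $\int_{\mathbb R}k_i(y)\,dy=1$ and $\int_{\mathbb R}k_i(y)e^{\lambda y}dy<\infty$ for every $\lambda\ge0$. Define $$c^*=\max_{i=1,2}\ \inf_{\lambda>0}\frac{\ln\left((1+d_i)\int_{\mathbb R}e^{\lambda y}k_i(y)\,dy\right)}{\lambda},$$ which is positive. *)

(* Defs.v *)
From HB Require Import structures.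
From mathcomp Require Import all_boot all_order all_algebra.
From mathcomp Require Import all_classical all_reals all_analysis.

Set Implicit Arguments.
Unset Strict Implicit.
Unset Printing Implicit Defensive.
Import Order.TTheory GRing.Theory Num.Theory.
Import numFieldNormedType.Exports.

Local Open Scope classical_set_scope.
Local Open Scope ring_scope.

(* [lebesgue_measure] lives on the Borel sigma-algebra of R; here "measurable"
   means Lebesgue measurable, so the completed measure, which lives on the
   Caratheodory sigma-algebra, is used instead.  Its carrier type is
   convertible to R, but not canonically a ring, so the definitions
   below take their function on R itself. *)
Definition lebesgue_integrable (R : realType) (f : R -> R) : Prop :=
  (@completed_lebesgue_measure R).-integrable setT (EFin \o f).

Definition lebesgue_eint (R : realType) (f : R -> R) : \bar R :=
  integral (@completed_lebesgue_measure R) setT (EFin \o f).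

Definition lebesgue_int (R : realType) (f : R -> R) : R :=
  fine (lebesgue_eint f).

Definition admissible_kernel (R : realType) (k : R -> R) : Prop :=
  [/\ forall x : R, 0 <= k x,
      lebesgue_integrable k,
      forall x : R, k x = k (- x),
      lebesgue_int k = 1 &
      forall lambda : R, 0 <= lambda ->
        (lebesgue_eint (fun y : R => (k y * expR (lambda * y))%R) < +oo)%E].

Definition linear_speed (R : realType) (d : R) (k : R -> R) : R :=
  inf [set ln ((1 + d) * lebesgue_int (fun y : R => expR (lambda * y) * k y))
             / lambda | lambda in [set lambda : R | 0 < lambda]].

Definition cstar (R : realType) (d1 d2 : R) (k1 k2 : R -> R) : R :=
  Num.max (linear_speed d1 k1) (linear_speed d2 k2).

(* First equation of the wave system; the second one is obtained by exchanging
   the roles of [u] and [v]. *)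
Definition wave_equation (R : realType) (c d b a : R) (k u v : R -> R) : Prop :=
  forall xi : R,
    u (xi + c) = lebesgue_int (fun y : R =>
      (1 + d) * u (xi - y)
        / (1 + d * (u (xi - y) + b * u (xi - y - c) + a * v (xi - y)))
      * k y).

Definition bounded_unif_continuous (R : realType) (u : R -> R) : Prop :=
  bounded_fun u /\ unif_continuous u.

(* Main.v *)
Require Import Defs.
From HB Require Import structures.
From mathcomp Require Import all_boot all_order all_algebra.
From mathcomp Require Import all_classical all_reals all_analysis.
From mathcomp Require Import measurable_realfun.
From mathcomp Require Import ring lra.

Set Implicit Arguments.
Unset Strict Implicit.
Unset Printing Implicit Defensive.
Import Order.TTheory GRing.Theory Num.Theory.
Import numFieldNormedType.Exports.

Local Open Scope classical_set_scope.
Local Open Scope ring_scope.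

(** Suppose that the first equation is the one whose linear speed exceeds [c];
    the other case is symmetric. A wave tends to zero at [-oo], so far to the
    left its first component [u] satisfies
    [u (x + c) >= a * \int w (y) * u (x - y) * k (y) dy] for every truncation [w]
    of the kernel and every [a < 1 + d]. The idea is to compare [u] with a
    compactly supported function that this linear operator makes grow by a
    factor larger than one: iterating, [u] would be unbounded at a point.

    Such a function exists because [c] is below the linear speed. Let [laplace l]
    be the integral of [expR (- l * (y + c)) * k y]. The assumption on [c]
    gives [1 < (1 + d) * laplace l] for all [l], and it makes [laplace] coercive
    in [l > 0]; evenness of the kernel, which rests on the invariance of the
    completed Lebesgue measure under reflection ([lebesgue_eintN]), takes care
    of [l < 0]. So [laplace] has a global minimizer [l0]
    ([laplace_minimizer]), and there the tilted kernel
    [expR (- l0 * (y + c)) * k y], seen as a measure in [y + c], has mean zero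
    ([tilted_mean0]), while its mass times [1 + d] is larger than one. A
    truncation that keeps the mean equal to zero costs little mass
    ([centered_weight]).

    For a measure of mean zero, mass larger than one and bounded support, a wide
    bump is multiplied by almost the mass: the first-order term of its
    expansion integrates to zero, the second-order one is small compared with
    the bump in the interior, and it has the good sign near the edge, where
    the bump is convex ([bump_tangent]). Multiplying by [expR (l0 * x)] undoes
    the tilt ([tilted_bump_subsolution]), and the comparison is
    [no_positive_supersolution]. *)

(** * Reflection invariance of the completed Lebesgue measure *)

Section CompletedMeasure.
Variable R : realType.

Notation cmu := (@completed_lebesgue_measure R).
Notation ctype := (caratheodory_type (@wlength R idfun)^*%mu).

(** The outer measure is the infimum over open supersets, and on open sets the
    Borel Lebesgue measure is already known to be reflection invariant. *)
Lemma outer_measureN_le (A : set R) :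
  (((@wlength R idfun)^* (-%R @^-1` A))%mu <= ((@wlength R idfun)^* A)%mu)%E.
Proof.
rewrite [leRHS]outer_measure_open; apply: le_ereal_inf_tmp => _ [U [oU AU] <-].
have mU : measurable (U : set R) by exact: open_measurable.
apply: (@le_trans _ _ ((wlength idfun)^* (-%R @^-1` U))%mu).
  by apply: le_outer_measure => x /=; exact: AU.
by rewrite le_eqVlt; apply/orP; left; apply/eqP; exact: lebesgue_measureN.
Qed.

Lemma outer_measureN (A : set R) :
  ((@wlength R idfun)^* (-%R @^-1` A))%mu = ((@wlength R idfun)^* A)%mu.
Proof.
apply/eqP; rewrite eq_le outer_measureN_le/=.
rewrite -[in leLHS](_ : -%R @^-1` (-%R @^-1` A) = A) ?outer_measureN_le//.
by apply/seteqP; split => x /=; rewrite opprK.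
Qed.

(** Reflection maps the Caratheodory criterion for a set to the criterion for
    its mirror image, tested on mirrored sets. *)
Lemma measurable_fun_reflection :
  measurable_fun setT (-%R : ctype -> ctype).
Proof.
move=> _ A mA; rewrite setTI.
suff : caratheodory_measurable (@wlength R idfun)^*%mu (-%R @^-1` A) by [].
have {}mA : caratheodory_measurable (@wlength R idfun)^*%mu A by [].
move=> X.
have := mA (-%R @^-1` X); rewrite outer_measureN => ->.
congr (_ + _)%E; rewrite -outer_measureN; congr mu_ext;
  by apply/seteqP; split => x /=; rewrite opprK.
Qed.

Lemma continuous_measurable_completed (f : R -> R) :
  continuous f -> measurable_fun setT (f : ctype -> R).
Proof.
move=> cf _ B mB; have := @continuous_measurable_fun R f cf measurableT B mB.
exact: sub_caratheodory.
Qed.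

(** The reflection pushes the completed measure forward to itself. *)
Lemma lebesgue_eintN (f : R -> R) :
  measurable_fun setT (f : ctype -> R) -> (forall x, 0 <= f x) ->
  lebesgue_eint (fun x => f (- x)) = lebesgue_eint f.
Proof.
move=> mf f0; rewrite /lebesgue_eint.
transitivity (integral (pushforward cmu (-%R : ctype -> ctype)) setT (EFin \o f)).
  rewrite ge0_integral_pushforward//.
  - exact: measurable_fun_reflection.
  - exact/measurable_EFinP.
  - by move=> y _; rewrite /= lee_fin.
apply: eq_measure_integral; first exact: measurable_fun_reflection.
by move=> mN A mA _; exact: (outer_measureN A).
Qed.
End CompletedMeasure.

(** * Integration against an admissible kernel *)

Section Tame.
Variable R : realType.

Notation cmu := (@completed_lebesgue_measure R).
Notation ctype := (caratheodory_type (@wlength R idfun)^*%mu).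

(** An algebra of functions that an admissible kernel integrates: it contains
    the bounded continuous functions, the polynomials and the exponentials, so
    that every integral below is a value of one monotone linear functional. *)
Definition tame (f : R -> R) :=
  continuous f /\
  exists C A, forall y, `|f y| <= C * expR (A * `|y|).

Lemma tameE (f : R -> R) : tame f ->
  exists C A, [/\ 0 <= C, 0 <= A & forall y, `|f y| <= C * expR (A * `|y|)].
Proof.
move=> [_ [C [A CA]]]; exists C, (Num.max A 0).
have C0 : 0 <= C.
  by have := le_trans (normr_ge0 _) (CA 0); rewrite normr0 mulr0 expR0 mulr1.
split => //; first by rewrite le_max lexx orbT.
move=> y; apply: le_trans (CA y) _; apply: ler_wpM2l => //.
by rewrite ler_expR ler_wpM2r// le_max lexx.
Qed.

Lemma tame_bounded (f : R -> R) M : continuous f -> (forall y, `|f y| <= M) ->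
  tame f.
Proof.
by move=> cf fM; split => //; exists M, 0 => y; rewrite mul0r expR0 mulr1.
Qed.

Lemma tame_cst (a : R) : tame (fun=> a).
Proof. by apply: (@tame_bounded _ `|a|) => // x; exact: cvg_cst. Qed.

Lemma tame_lin (a b : R) : tame (fun y => a * y + b).
Proof.
split.
  by move=> x; apply: cvgD; [apply: cvgM; [exact: cvg_cst|exact: cvg_id]|exact: cvg_cst].
exists (`|a| + `|b|), 1 => y.
rewrite mul1r; have := expR_ge1Dx `|y|; have := normr_ge0 y.
have := normr_ge0 a; have := normr_ge0 b.
have := ler_normD (a * y) b; rewrite normrM; nra.
Qed.

Lemma tame_expR (a b : R) : tame (fun y => expR (a * y + b)).
Proof.
split.
  move=> x; apply: (@continuous_comp _ _ _ (fun y => a * y + b) expR).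
    exact: (tame_lin a b).1.
  exact: continuous_expR.
exists (expR b), `|a| => y.
rewrite ger0_norm ?expR_ge0// [leRHS]mulrC -expRD ler_expR lerD2r -normrM.
exact: ler_norm.
Qed.

Lemma tame_expRM (a : R) : tame (fun y => expR (a * y)).
Proof.
have -> : (fun y => expR (a * y)) = (fun y => expR (a * y + 0)).
  by apply/funext => y; rewrite addr0.
exact: tame_expR.
Qed.

Lemma tameD f g : tame f -> tame g -> tame (fun y => f y + g y).
Proof.
move=> tf tg; split; first by move=> x; apply: cvgD; [exact: tf.1|exact: tg.1].
have [C [A [C0 A0 fC]]] := tameE tf; have [D [B [D0 B0 gD]]] := tameE tg.
exists (C + D), (A + B) => y.
have h : expR (A * `|y|) <= expR ((A + B) * `|y|).
  by rewrite ler_expR ler_wpM2r// lerDl.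
have k : expR (B * `|y|) <= expR ((A + B) * `|y|).
  by rewrite ler_expR ler_wpM2r// lerDr.
have := fC y; have := gD y; have := ler_normD (f y) (g y).
have := ler_wpM2l C0 h; have := ler_wpM2l D0 k; lra.
Qed.

Lemma tameM f g : tame f -> tame g -> tame (fun y => f y * g y).
Proof.
move=> tf tg; split; first by move=> x; apply: cvgM; [exact: tf.1|exact: tg.1].
have [C [A [C0 A0 fC]]] := tameE tf; have [D [B [D0 B0 gD]]] := tameE tg.
exists (C * D), (A + B) => y.
rewrite mulrDl expRD mulrACA normrM.
by apply: ler_pM.
Qed.

Lemma tameZ a f : tame f -> tame (fun y => a * f y).
Proof. by move=> tf; exact: (tameM (tame_cst a) tf). Qed.

Lemma tameB f g : tame f -> tame g -> tame (fun y => f y - g y).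
Proof.
move=> tf tg; have -> : (fun y => f y - g y) = (fun y => f y + -1 * g y).
  by apply/funext => y; rewrite mulN1r.
by apply: tameD => //; exact: tameZ.
Qed.

Lemma tame_norm f : tame f -> tame (fun y => `|f y|).
Proof.
move=> [cf [C [A fC]]]; split; first by move=> x; apply: cvg_norm; exact: cf.
by exists C, A => y; rewrite normr_id.
Qed.

Lemma tameX f n : tame f -> tame (fun y => f y ^+ n).
Proof.
move=> tf; elim: n => [|n IH].
  by have := tame_cst 1; congr tame; apply/funext => y; rewrite expr0.
have := tameM tf IH; congr tame; apply/funext => y; rewrite exprS//.
Qed.

Variable k : R -> R.
Hypothesis hk : admissible_kernel k.

Definition kint (f : R -> R) : R := lebesgue_int (fun y => f y * k y).

Let k0 x : 0 <= k x. Proof. by case: hk. Qed.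

Let mk : measurable_fun setT (k : ctype -> R).
Proof.
case: hk => _ ik _ _ _; apply/measurable_EFinP.
exact: (measurable_int cmu ik).
Qed.

Let mfk (f : R -> R) : continuous f ->
  measurable_fun setT ((fun y => f y * k y) : ctype -> R).
Proof.
by move=> cf; apply: measurable_funM => //; exact: continuous_measurable_completed.
Qed.

(** For a negative exponent, evenness of the kernel reduces the claim to the
    opposite exponent. *)
Lemma expR_kernel_lty (a : R) :
  (lebesgue_eint (fun y => (expR (a * y) * k y)%R) < +oo)%E.
Proof.
case: (hk) => _ _ ek _ fk.
have [a0|a0] := leP 0 a.
  have := fk a a0; congr (lebesgue_eint _ < _)%E.
  by apply/funext => y; rewrite mulrC.
rewrite -lebesgue_eintN; last 2 first.
- exact/mfk/(tame_expRM a).1.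
- by move=> x; rewrite mulr_ge0// expR_ge0.
have := fk (- a); rewrite oppr_ge0 => /(_ (ltW a0)).
congr (lebesgue_eint _ < _)%E.
by apply/funext => y; rewrite -ek mulrC mulrN mulNr.
Qed.

(** Domination by [C * (expR (A * y) + expR (- A * y)) * k y]. *)
Lemma tame_integrable f : tame f -> lebesgue_integrable (fun y => f y * k y).
Proof.
move=> tf; have [C [A [C0 A0 fC]]] := tameE tf.
have ie a : cmu.-integrable setT (EFin \o ((fun y => expR (a * y) * k y) : ctype -> R)).
  apply/integrableP; split.
    exact/measurable_EFinP/mfk/(tame_expRM a).1.
  apply: le_lt_trans (expR_kernel_lty a).
  rewrite le_eqVlt; apply/orP; left; apply/eqP; apply: eq_integral => x _ /=.
  by rewrite ger0_norm// mulr_ge0// expR_ge0.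
have cf := tf.1.
have ig : cmu.-integrable setT
    (EFin \o ((fun y => C * (expR (A * y) * k y + expR (- A * y) * k y)) : ctype -> R)).
  have := integrableZl measurableT C (integrableD measurableT (ie A) (ie (- A))).
  by apply: eq_integrable => // x _ /=; rewrite EFinM EFinD.
apply: (le_integrable measurableT _ _ ig).
  exact/measurable_EFinP/mfk.
move=> x _ /=; rewrite lee_fin [leRHS]ger0_norm; last first.
  by rewrite mulr_ge0// addr_ge0// mulr_ge0// expR_ge0.
rewrite normrM (ger0_norm (k0 x)) -mulrDl mulrA ler_wpM2r//.
apply: le_trans (fC x) _; rewrite ler_wpM2l//.
have [x0|x0] := leP 0 x; first by rewrite ger0_norm// lerDl expR_ge0.
by rewrite ltr0_norm// mulrN mulNr lerDr expR_ge0.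
Qed.

Lemma kintE f : kint f = Rintegral cmu setT ((fun y => f y * k y) : ctype -> R).
Proof. by []. Qed.

Lemma kintD f g : tame f -> tame g ->
  kint (fun y => f y + g y) = kint f + kint g.
Proof.
move=> tf tg; rewrite !kintE -RintegralD//; [|exact: tame_integrable..].
by congr Rintegral; apply/funext => y; rewrite mulrDl.
Qed.

Lemma kintZ a f : tame f -> kint (fun y => a * f y) = a * kint f.
Proof.
move=> tf; rewrite !kintE -RintegralZl//; last exact: tame_integrable.
by congr Rintegral; apply/funext => y; rewrite mulrA.
Qed.

Lemma kintB f g : tame f -> tame g ->
  kint (fun y => f y - g y) = kint f - kint g.
Proof.
move=> tf tg; rewrite -mulN1r -kintZ// -kintD//; last exact: tameZ.
by congr kint; apply/funext => y; rewrite mulN1r.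
Qed.

Lemma le_kint f g : tame f -> tame g -> (forall y, f y <= g y) ->
  kint f <= kint g.
Proof.
move=> tf tg fg; rewrite !kintE; apply: le_Rintegral => //;
  [exact: tame_integrable..|].
by move=> x _; apply: ler_wpM2r.
Qed.

Lemma kint_ge0 f : (forall y, 0 <= f y) -> 0 <= kint f.
Proof.
by move=> f0; rewrite kintE; apply: Rintegral_ge0 => x _; rewrite mulr_ge0.
Qed.

Lemma kint1 : kint (fun=> 1) = 1.
Proof.
rewrite /kint (_ : (fun y => _) = k); first by case: hk.
by apply/funext => y; rewrite mul1r.
Qed.

Lemma kint_expRN a : kint (fun y => expR (- a * y)) = kint (fun y => expR (a * y)).
Proof.
rewrite /kint /lebesgue_int -[in RHS]lebesgue_eintN; last 2 first.
- exact/mfk/(tame_expRM a).1.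
- by move=> x; rewrite mulr_ge0// expR_ge0.
congr (fine (lebesgue_eint _)); apply/funext => y.
by case: hk => _ _ ek _ _; rewrite -ek mulrN mulNr.
Qed.

End Tame.

(** * The tilted kernel at the minimum of its Laplace transform *)

Section ExpInequalities.
Variable R : realType.
Implicit Types a b x l m z : R.

Lemma expR_dist a b : `|expR a - expR b| <= `|a - b| * (expR a + expR b).
Proof.
wlog ab : a b / b <= a => [th|].
  have [/th//|ba] := leP b a.
  by rewrite (distrC (expR a)) (distrC a) (addrC (expR a)); apply: th; exact: ltW.
have e : expR b = expR a * expR (b - a) by rewrite -expRD addrC subrK.
have := expR_ge1Dx (b - a); have := expR_gt0 a; have := expR_gt0 b.
have : expR b <= expR a by rewrite ler_expR.
move=> le1 p1 p2 h; rewrite !ger0_norm ?subr_ge0//.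
have : expR b >= expR a * (1 + (b - a)) by rewrite e ler_pM2l.
have : 0 <= (a - b) * expR b by rewrite mulr_ge0 ?subr_ge0// ltW.
nra.
Qed.

Lemma expR_le_taylor2 x : expR x <= 1 + x + x ^+ 2 * expR `|x|.
Proof.
have h1 := expR_ge1Dx x; have h2 := expR_ge1Dx (- x).
have h3 : expR x * expR (- x) = 1 by rewrite -expRD subrr expR0.
have p1 := expR_gt0 x; have p2 := expR_gt0 (- x).
have h4 : expR x * (1 - x) <= 1.
  by rewrite -[leRHS]h3 ler_pM2l.
have [x0|x0] := leP 0 x.
  rewrite ger0_norm//; have := ler_wpM2l x0 h4; lra.
rewrite ltr0_norm//.
have h5 : 0 <= x ^+ 2 * (expR (- x) - 1) by rewrite mulr_ge0 ?sqr_ge0//; lra.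
have h6 : 0 <= - x * (expR x - 1 - x) by apply: mulr_ge0; lra.
lra.
Qed.

(** Exponents of size at most [m] are controlled by the two extreme ones, which
    gives a dominating function uniform in the exponent. *)
Lemma expR_norm_le l m z : `|l| <= m ->
  expR `|l * z| <= expR (m * z) + expR (- m * z).
Proof.
move=> lm; have p := expR_gt0 (m * z); have p' := expR_gt0 (- m * z).
have h : `|l * z| <= m * `|z| by rewrite normrM ler_wpM2r.
apply: (@le_trans _ _ (expR (m * `|z|))); first by rewrite ler_expR.
have [z0|z0] := leP 0 z; first by rewrite ger0_norm//; lra.
by rewrite ltr0_norm// mulrN -mulNr; lra.
Qed.

End ExpInequalities.

Section MoreTame.
Variable R : realType.

Lemma tame_shift (c : R) : tame (fun y => y + c).
Proof.
by have := tame_lin 1 c; congr tame; apply/funext => y; rewrite mul1r.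
Qed.

Lemma tame_expR_shift (a c : R) : tame (fun y => expR (a * (y + c))).
Proof.
have := tame_expR a (a * c); congr tame; apply/funext => y; rewrite mulrDr//.
Qed.

End MoreTame.

(** Closure of tame functions, driven by the shape of the expression alone;
    unification up to conversion would unfold the exponential. *)
Ltac tame := lazymatch goal with
  | |- tame (fun=> ?a) => exact: tame_cst
  | |- tame (fun y => y + ?c) => exact: tame_shift
  | |- tame (fun y => expR (?a * (y + ?c))) => exact: tame_expR_shift
  | |- tame (fun y => expR (?a * y)) => exact: tame_expRM
  | |- tame (fun y => @?f y - @?g y) => apply: (@tameB _ f g); tame
  | |- tame (fun y => @?f y + @?g y) => apply: (@tameD _ f g); tame
  | |- tame (fun y => @?f y * @?g y) => apply: (@tameM _ f g); tame
  | |- tame (fun y => @?f y ^+ ?n) => apply: (@tameX _ f n); tame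
  | |- tame (fun y => `|@?f y|) => apply: (@tame_norm _ f); tame
  | |- tame _ => assumption
  | |- admissible_kernel _ => assumption
  end.

Section Tilt.
Variables (R : realType) (k : R -> R) (d c s : R).
Hypothesis hk : admissible_kernel k.
Hypothesis d0 : 0 < d.
Hypothesis c0 : 0 < c.
Hypothesis cs : c < s.
Hypothesis hs : forall l, 0 < l ->
  expR (l * s) <= (1 + d) * kint k (fun y => expR (l * y)).

(** The Laplace transform of the law of [y + c], where [y] has density [k]:
    [y + c] is the displacement relative to the frame of the wave. *)
Definition laplace (l : R) := kint k (fun y => expR (- l * (y + c))).

Lemma laplaceE l : laplace l = expR (- l * c) * kint k (fun y => expR (- l * y)).
Proof.
rewrite -(kintZ hk); last by tame.
by congr kint; apply/funext => y; rewrite -expRD -mulrDr addrC.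
Qed.

Lemma laplace0 : laplace 0 = 1.
Proof.
rewrite -[RHS](kint1 hk); congr kint; apply/funext => y.
by rewrite oppr0 mul0r expR0.
Qed.

(** By evenness of the kernel, [laplace (- l)] is [laplace l] multiplied by
    [expR (2 * l * c)]: a minimizer can be sought among nonnegative [l]. *)
Lemma laplaceN l : 0 <= l -> laplace l <= laplace (- l).
Proof.
move=> l0; rewrite !laplaceE kint_expRN// !opprK ler_wpM2r//.
  by apply: kint_ge0 => // y; exact: expR_ge0.
by rewrite ler_expR; have := mulr_ge0 l0 (ltW c0); lra.
Qed.

(** The gap [s - c] between the linear speed and the wave speed makes [laplace]
    coercive and keeps [(1 + d) * laplace l] above [1] for [l > 0]. *)
Lemma laplace_growth l : 0 < l -> expR (l * (s - c)) <= (1 + d) * laplace l.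
Proof.
move=> l0; rewrite laplaceE kint_expRN// mulrCA.
have -> : expR (l * (s - c)) = expR (- l * c) * expR (l * s).
  by rewrite -expRD; congr expR; ring.
by rewrite ler_wpM2l ?expR_ge0// hs.
Qed.

Lemma laplace_lipschitz L : exists2 C, 0 <= C &
  forall l m, `|l| <= L -> `|m| <= L -> `|laplace l - laplace m| <= C * `|l - m|.
Proof.
pose h y := `|y + c| * (2 * (expR (L * (y + c)) + expR (- L * (y + c)))).
have th : tame h by rewrite /h; tame.
exists (kint k h).
  by apply: kint_ge0 => // y; rewrite /h mulr_ge0// mulr_ge0// addr_ge0// expR_ge0.
move=> l m hl hm.
have key y : `|expR (- l * (y + c)) - expR (- m * (y + c))| <= `|l - m| * h y.
  apply: le_trans (expR_dist _ _) _.
  rewrite -mulrBl normrM opprK (addrC (- l)) distrC -mulrA /h.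
  apply: ler_wpM2l => //; apply: ler_wpM2l => //.
  have aux n : `|n| <= L -> expR (- n * (y + c)) <=
      expR (L * (y + c)) + expR (- L * (y + c)).
    move=> nL; apply: le_trans (expR_norm_le (y + c) nL).
    by rewrite ler_expR mulNr -normrN ler_norm.
  by have := aux _ hl; have := aux _ hm; lra.
rewrite mulrC -kintZ// ler_norml -(kintB hk); try by tame.
apply/andP; split; last first.
  apply: (le_kint hk); [by tame..|] => y.
  by have := key y; rewrite ler_norml => /andP[].
rewrite -mulN1r -(kintZ hk); last by tame.
apply: (le_kint hk); [by tame..|] => y.
by have := key y; rewrite ler_norml => /andP[h1 _]; rewrite mulN1r.
Qed.

Lemma laplace_continuous : continuous laplace.
Proof.
move=> x; have [C C0 lipC] := laplace_lipschitz (`|x| + 1).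
apply/cvgrPdist_lt => e e0; near=> y.
have xy : `|x - y| < Num.min 1 (e / (C + 1)).
  by near: y; apply: cvgr_dist_lt => //; rewrite lt_min ltr01 divr_gt0// ltr_wpDl.
move: xy; rewrite lt_min => /andP[xy1]; rewrite ltr_pdivlMr ?ltr_wpDl// => xy2.
apply: le_lt_trans (lipC x y _ _) _; first by rewrite lerDl.
  have := ler_normB x (x - y); rewrite subKr; lra.
by have := normr_ge0 (x - y); nra.
Unshelve. all: by end_near. Qed.

(** A global minimum over all real [l]: continuity gives a minimum on a compact
    interval [0, L], growth excludes [l > L] and reflection excludes
    [l < 0]. *)
Lemma laplace_minimizer : exists l0, [/\ forall l, laplace l0 <= laplace l,
  1 < (1 + d) * laplace l0 & exists l, laplace l0 < laplace l].
Proof.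
have sc : 0 < s - c by rewrite subr_gt0.
have big l : 0 < l -> 1 + l * (s - c) <= (1 + d) * laplace l.
  by move=> l0; apply: le_trans (laplace_growth l0); exact: expR_ge1Dx.
pose L := d / (s - c) + 1.
have L0 : 0 < L by rewrite /L ltr_wpDl// divr_ge0// ltW.
have outside l : L <= l -> laplace 0 < laplace l.
  move=> Ll; have l0 := lt_le_trans L0 Ll.
  rewrite laplace0 -(ltr_pM2l (_ : 0 < 1 + d)) ?mulr1; last by rewrite addr_gt0.
  apply: lt_le_trans (big l l0); rewrite ltrD2l -ltr_pdivrMr//.
  by apply: lt_le_trans Ll; rewrite /L ltrDl.
have [l0] := EVT_min (ltW L0) (continuous_subspaceT laplace_continuous).
rewrite in_itv/= => /andP[l00 l0L] minl0.
have m0 : laplace l0 <= laplace 0 by apply: minl0; rewrite in_itv/= lexx ltW.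
have minp l : 0 <= l -> laplace l0 <= laplace l.
  move=> lp; have [lL|/ltW/outside/ltW] := leP l L.
    by apply: minl0; rewrite in_itv/= lp.
  exact: le_trans.
exists l0; split.
- move=> l; have [/minp//|ln] := leP 0 l.
  have nl : 0 <= - l by lra.
  by apply: le_trans (minp _ nl) _; have := laplaceN nl; rewrite opprK.
- move: l00; rewrite le_eqVlt => /orP[/eqP <-|l00].
    by rewrite laplace0 mulr1 ltrDl.
  apply: lt_le_trans (big l0 l00); rewrite ltrDl mulr_gt0//.
- by exists L; apply: le_lt_trans m0 _; exact: outside.
Qed.

(** The vanishing of the derivative of [laplace] at a minimizer. The
    second-order bound [expR_le_taylor2] replaces differentiation under the
    integral sign: [t * m <= t ^+ 2 * T] for small [t] of both signs forces
    [m = 0]. *)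
Lemma tilted_mean0 l0 : (forall l, laplace l0 <= laplace l) ->
  kint k (fun y => (y + c) * expR (- l0 * (y + c))) = 0.
Proof.
move=> minl0; set m := kint k _.
pose T y := (y + c) ^+ 2 * (expR (1 * (y + c)) + expR (- 1 * (y + c))) * expR (- l0 * (y + c)).
have tT : tame T by rewrite /T; tame.
have T0 : 0 <= kint k T.
  apply: kint_ge0 => // y.
  by rewrite /T mulr_ge0 ?expR_ge0// mulr_ge0 ?sqr_ge0// addr_ge0 ?expR_ge0.
have key t : `|t| <= 1 -> t * m <= t ^+ 2 * kint k T.
  move=> t1.
  have : laplace (l0 + t) <= laplace l0 - t * m + t ^+ 2 * kint k T.
    rewrite /laplace /m -!(kintZ hk); try by tame.
    rewrite -(kintB hk); try by tame.
    rewrite -(kintD hk); try by tame.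
    apply: (le_kint hk); [by tame..|] => y; set z := y + c.
    rewrite opprD mulrDl expRD /T -/z.
    have h1 := expR_le_taylor2 (- t * z).
    have h2 : expR `|- t * z| <= expR (1 * z) + expR (- 1 * z).
      by apply: expR_norm_le; rewrite normrN.
    have h3 := ler_wpM2l (sqr_ge0 (- t * z)) h2.
    have h4 : expR (- t * z) <= 1 - t * z + t ^+ 2 * (z ^+ 2 * (expR (1 * z) + expR (- 1 * z))).
      by move: h1 h3; lra.
    have := ler_wpM2l (expR_ge0 (- l0 * z)) h4; lra.
  have := minl0 (l0 + t); lra.
have mT : 0 < `|m| + kint k T + 1 by have := normr_ge0 m; lra.
(* the sign of [m] makes [t * m] positive, the small factor beats [t ^+ 2] *)
pose t := Num.sg m * (`|m| / (`|m| + kint k T + 1)).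
apply/eqP; apply: contraT => mn0.
have am : 0 < `|m| by rewrite normr_gt0.
have q1 : `|m| / (`|m| + kint k T + 1) <= 1 by rewrite ler_pdivrMr//; lra.
have q0 : 0 < `|m| / (`|m| + kint k T + 1) by rewrite divr_gt0.
have := key t; rewrite /t normrM normr_sg mn0 mul1r ger0_norm ?(ltW q0)// => /(_ q1).
rewrite mulrAC exprMn sqr_sg mn0 mul1r -normrEsg.
have qE : `|m| / (`|m| + kint k T + 1) * (`|m| + kint k T + 1) = `|m|.
  by rewrite divfK// gt_eqF.
move: (_ / _) q0 q1 qE => q q0 q1 qE; rewrite mulrC expr2 -mulrA ler_pM2l//.
nra.
Qed.

(** If the second moment vanished, the kernel would live on the single point
    [- c] and [laplace] would be constant. The integral form of this remark is
    the bound of [laplace m - laplace l0] by a multiple of [A * S + A^-1 * Q] for every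
    [A > 0], with [S] the second moment. *)
Lemma tilted_variance_gt0 l0 :
  (exists l, laplace l0 < laplace l) ->
  0 < kint k (fun y => (y + c) ^+ 2 * expR (- l0 * (y + c))).
Proof.
move=> [m lm]; rewrite ltNge; apply/negP; set S := kint k _ => S0.
pose P y := expR ((l0 - m) * (y + c)).
have tP : tame P by rewrite /P; tame.
pose Q y := (P y + 1) ^+ 2 * expR (- l0 * (y + c)).
have tQ : tame Q by rewrite /Q; tame.
have Q0 : 0 <= kint k Q.
  by apply: kint_ge0 => // y; rewrite /Q mulr_ge0 ?sqr_ge0// expR_ge0.
have key A : 0 < A -> laplace m - laplace l0 <= `|l0 - m| * (A * S + A^-1 * kint k Q).
  move=> A0; rewrite /laplace /S -!(kintZ hk); try by tame.
  rewrite -(kintD hk); try by tame.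
  rewrite -(kintZ hk); try by tame.
  rewrite -(kintB hk); try by tame.
  apply: (le_kint hk); [by tame..|] => y; set z := y + c.
  have -> : expR (- m * z) = P y * expR (- l0 * z).
    by rewrite /P -expRD -/z; congr expR; ring.
  rewrite /Q -/z.
  have h1 : P y - 1 <= `|l0 - m| * (`|z| * (P y + 1)).
    have := expR_dist ((l0 - m) * z) 0.
    by rewrite subr0 expR0 normrM -mulrA -/(P y); apply: le_trans; exact: ler_norm.
  have h2 : `|z| * (P y + 1) <= A * z ^+ 2 + A^-1 * (P y + 1) ^+ 2.
    have -> : z ^+ 2 = `|z| ^+ 2 by rewrite real_normK// num_real.
    have P1 : 0 < P y + 1 by rewrite addr_gt0// expR_gt0.
    move: (P y + 1) P1 (normr_ge0 z) => p p0; move: `|z| => w w0.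
    have e : A^-1 * (A * w - p) ^+ 2 = A * w ^+ 2 - 2 * (w * p) + A^-1 * p ^+ 2.
      by field; rewrite gt_eqF.
    have : 0 <= A^-1 * (A * w - p) ^+ 2.
      by rewrite mulr_ge0 ?sqr_ge0// invr_ge0 ltW.
    rewrite e; have := mulr_ge0 w0 (ltW p0); lra.
  have h3 := ler_wpM2l (normr_ge0 (l0 - m)) h2.
  have h4 := ler_wpM2r (expR_ge0 (- l0 * z)) (le_trans h1 h3).
  lra.
have dlt : 0 < laplace m - laplace l0 by rewrite subr_gt0.
set D := laplace m - laplace l0 in key dlt.
have N0 := normr_ge0 (l0 - m).
pose A := (`|l0 - m| * kint k Q + 1) / D.
have A0 : 0 < A by rewrite divr_gt0// ltr_wpDl// mulr_ge0.
have : D <= `|l0 - m| * (A^-1 * kint k Q).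
  apply: le_trans (key A A0) _; rewrite ler_wpM2l// gerDr; nra.
rewrite mulrCA -ler_pdivrMl ?invr_gt0// invrK /A divfK ?gt_eqF//.
by rewrite gerDl ler10.
Qed.
End Tilt.

(** A positive [linear_speed] is a genuine infimum, because the infimum of a
    set without lower bound is [0]; and the logarithms are then positive, which
    excludes the default value of [ln] outside the positive reals. *)
Lemma linear_speed_growth (R : realType) (k : R -> R) (d c : R) :
  0 < c -> c < linear_speed d k ->
  forall l, 0 < l ->
    expR (l * linear_speed d k) <= (1 + d) * kint k (fun y => expR (l * y)).
Proof.
move=> c0; rewrite /linear_speed; set A := [set _ | _ in _] => cA l l0.
have lbA : has_lbound A.
  apply: contrapT => nlb; move: cA; rewrite inf_out; last by case.
  by rewrite ltNge (ltW c0).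
have : inf A <= ln ((1 + d) * kint k (fun y => expR (l * y))) / l.
  by apply: ge_inf => //; exists l.
rewrite ler_pdivlMr// mulrC => h.
have ln0 : 0 < ln ((1 + d) * kint k (fun y => expR (l * y))).
  by apply: lt_le_trans h; rewrite mulr_gt0// (lt_trans c0).
have p : 0 < (1 + d) * kint k (fun y => expR (l * y)).
  rewrite ltNge; apply/negP => /le_trans/(_ ler01)/ln_le0.
  by rewrite leNgt ln0.
by rewrite -[leRHS]lnK ?ler_expR.
Qed.

(** * A compactly supported centred weight *)

Section Weight.
Variable R : realType.

Lemma tame_pos_part (f : R -> R) : tame f -> tame (fun y => Num.max 0 (f y)).
Proof.
move=> tf; have -> : (fun y => Num.max 0 (f y)) = (fun y => 2^-1 * (f y + `|f y|)).
  apply/funext => y; have [f0|f0] := leP 0 (f y).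
    by rewrite ger0_norm//; lra.
  by rewrite ltr0_norm// subrr mulr0.
by tame.
Qed.

Variables (k E : R -> R) (c : R).
Hypothesis hk : admissible_kernel k.
Hypothesis tE : tame E.
Hypothesis E0 : forall y, 0 <= E y.
Hypothesis mean0 : kint k (fun y => (y + c) * E y) = 0.
Hypothesis var0 : 0 < kint k (fun y => (y + c) ^+ 2 * E y).

(** Truncating a centred measure spoils its mean. The weight
    [max 0 (1 - (z / n) ^+ 2) * (1 - t * z)], with [z = y + c], has mean zero
    for [t = m / V], where [m] and [V] are the first and second moments of the
    truncated measure. As [m] is of order [n ^- 2] and [V] stays away from [0],
    [t * z] is of order [n^-1] on the support, so that the weight is nonnegative
    and, after division by [1 + b], at most [1], while little mass is lost. *)
Lemma centered_weight g : 0 <= g -> g < kint k E ->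
  exists n h, [/\ 0 < n, tame h, (forall y, 0 <= h y <= 1),
    (forall y, n < `|y + c| -> h y = 0) &
    kint k (fun y => h y * ((y + c) * E y)) = 0 /\
    g < kint k (fun y => h y * E y)].
Proof.
move=> g0 gM; set M := kint k E in gM; 
pose S := kint k (fun y => (y + c) ^+ 2 * E y); have S0 : 0 < S := var0.
pose q := kint k (fun y => `|y + c| ^+ 3 * E y).
pose p := kint k (fun y => (y + c) ^+ 4 * E y).
have q0 : 0 <= q by apply: kint_ge0 => // y; rewrite mulr_ge0// exprn_ge0.
have p0 : 0 <= p.
  by apply: kint_ge0 => // y; rewrite mulr_ge0// (exprM _ 2 2) sqr_ge0.
pose b := Num.min 1 ((M - g) / (2 * (1 + g))).
have b0 : 0 < b.
  by rewrite lt_min ltr01/= divr_gt0 ?subr_gt0// mulr_gt0// ltr_wpDr.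
have b1 : b <= 1 by rewrite ge_min lexx.
have bg : b * (1 + g) < M - g.
  have : b <= (M - g) / (2 * (1 + g)) by rewrite ge_min lexx orbT.
  rewrite ler_pdivlMr; [nra|lra].
(* the summands of [n] answer, in this order, the needs [1 <= n], [np], [nq]
   and [nS] below *)
pose n := 1 + 2 * p / S + 2 * q / (S * b) + (S + 2 * q ^+ 2 / S) / b.
have t1 : 0 <= 2 * p / S by rewrite divr_ge0 ?mulr_ge0 ?(ltW S0).
have t2 : 0 <= 2 * q / (S * b) by rewrite divr_ge0 ?mulr_ge0 ?(ltW S0) ?(ltW b0).
have t3' : 0 <= 2 * q ^+ 2 / S by rewrite divr_ge0 ?mulr_ge0 ?sqr_ge0 ?(ltW S0).
have t3 : 0 <= (S + 2 * q ^+ 2 / S) / b by rewrite divr_ge0 ?(ltW b0)// addr_ge0 ?(ltW S0).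
have n1 : 1 <= n by rewrite /n; lra.
have n0 : 0 < n by lra.
have np : 2 * p <= n * S.
  by rewrite -ler_pdivrMr// /n; lra.
have nq : 2 * q <= n * (S * b).
  by rewrite -ler_pdivrMr ?mulr_gt0// /n; lra.
have nS : S + 2 * q ^+ 2 / S <= n * b.
  by rewrite -ler_pdivrMr// /n; lra.
pose e := n ^- 2.
have e0 : 0 < e by rewrite invr_gt0 exprn_gt0.
have en : e * n ^+ 2 = 1 by rewrite mulVf// gt_eqF// exprn_gt0.
have en1 : e * n <= 1 by rewrite -en expr2 mulrA ler_peMr// mulr_ge0// ltW.
have e1 : e <= 1 by apply: le_trans en1; rewrite ler_peMr// ltW.
pose chi y := Num.max 0 (1 - e * (y + c) ^+ 2).
have tchi : tame chi by apply: tame_pos_part; tame.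
have chi0 y : 0 <= chi y by rewrite /chi le_max lexx.
have chi1 y : chi y <= 1.
  rewrite /chi ge_max ler01 gerBl mulr_ge0 ?sqr_ge0//; exact: ltW.
have chie y : 1 - chi y <= e * (y + c) ^+ 2.
  have : 1 - e * (y + c) ^+ 2 <= chi y by rewrite /chi le_max lexx orbT.
  lra.
have chin y : n < `|y + c| -> chi y = 0.
  move=> h; rewrite /chi max_l// subr_le0 -en ler_wpM2l ?(ltW e0)//.
  by rewrite -[leRHS]real_normK ?num_real// ler_sqr ?nnegrE ?(ltW n0)// ltW.
pose m := kint k (fun y => chi y * ((y + c) * E y)).
pose V := kint k (fun y => chi y * ((y + c) ^+ 2 * E y)).
have me : `|m| <= e * q.
  rewrite -[m]subr0 -mean0 /m /q -(kintB hk); try by tame.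
  rewrite -(kintZ hk); last by tame.
  have key y : `|chi y * ((y + c) * E y) - (y + c) * E y| <= e * (`|y + c| ^+ 3 * E y).
    have -> : chi y * ((y + c) * E y) - (y + c) * E y = (chi y - 1) * ((y + c) * E y).
      by ring.
    rewrite !normrM (ger0_norm (E0 y)) distrC (@ger0_norm _ (1 - chi y)) ?subr_ge0//.
    rewrite [leLHS]mulrA [leRHS]mulrA ler_wpM2r// exprSr real_normK ?num_real//.
    by rewrite [leRHS]mulrA ler_wpM2r.
  rewrite ler_norml -mulN1r -(kintZ hk); last by tame.
  apply/andP; split; apply: (le_kint hk); try by tame.
    by move=> y; have := key y; rewrite ler_norml mulN1r => /andP[].
  by move=> y; have := key y; rewrite ler_norml => /andP[].
have Vlow : S / 2 <= V.
  have : S - V <= e * p.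
    rewrite /S /V /p -(kintB hk); try by tame.
    rewrite -(kintZ hk); last by tame.
    apply: (le_kint hk); try by tame.
    move=> y; have := chie y; set z := y + c => hz.
    have : 0 <= z ^+ 2 * E y by rewrite mulr_ge0 ?sqr_ge0.
    have -> : z ^+ 4 = z ^+ 2 * z ^+ 2 by ring.
    nra.
  have : e * p * 2 <= e * n * S by rewrite -!mulrA ler_wpM2l ?(ltW e0)//; lra.
  nra.
have V0 : 0 < V by lra.
have K1 : M - e * S <= kint k (fun y => chi y * E y).
  rewrite lerBlDr -lerBlDl /M /S -(kintB hk); try by tame.
  rewrite -(kintZ hk); last by tame.
  apply: (le_kint hk); try by tame.
  by move=> y; have := chie y; have := E0 y; nra.
have [t tV] : exists t, t * V = m by exists (m / V); rewrite divfK// gt_eqF.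
have tq : `|t| * S <= 2 * (e * q).
  have : `|t| * V = `|m| by rewrite -[in RHS]tV [RHS]normrM (gtr0_norm V0).
  have := normr_ge0 t; nra.
have tn : `|t| * n <= b.
  rewrite -(ler_pM2r S0) mulrAC.
  have h1 := ler_wpM2r (ltW n0) tq.
  have h2 : e * n * (2 * q) <= e * n * (n * (S * b)).
    by rewrite ler_wpM2l// mulr_ge0// ltW.
  have h3 : e * n * (n * (S * b)) = b * S.
    by transitivity (e * n ^+ 2 * (S * b)); [ring|rewrite en; ring].
  lra.
have tz y : chi y != 0 -> `|t * (y + c)| <= b.
  move=> cy; have yn : `|y + c| <= n.
    by rewrite leNgt; apply: contra cy => /chin ->.
  by rewrite normrM; apply: le_trans tn; rewrite ler_wpM2l.
pose h y := (1 + b)^-1 * (chi y * (1 - t * (y + c))).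
have th : tame h by rewrite /h; tame.
have b10 : 0 < 1 + b by lra.
exists n, h; split => //.
- move=> y; have [cy|cy] := eqVneq (chi y) 0.
    by rewrite /h cy mul0r mulr0 lexx ler01.
  have := tz y cy; rewrite ler_norml => /andP[h1 h2].
  rewrite /h mulr_ge0 ?invr_ge0 ?(ltW b10)//=; last first.
    by rewrite mulr_ge0//; lra.
  rewrite mulrC ler_pdivrMr// mul1r.
  by have := chi0 y; have := chi1 y; nra.
- by move=> y /chin cy; rewrite /h cy mul0r mulr0.
have hf f : tame f -> kint k (fun y => h y * f y) =
    (1 + b)^-1 * (kint k (fun y => chi y * f y) - t * kint k (fun y => chi y * ((y + c) * f y))).
  move=> tf; rewrite -(kintZ hk); last by tame.
  rewrite -(kintB hk); try by tame.
  rewrite -(kintZ hk); last by tame.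
  by congr kint; apply/funext => y; rewrite /h; ring.
split.
  rewrite hf; last by tame.
  rewrite -/m (_ : (fun y => _) = (fun y => chi y * ((y + c) ^+ 2 * E y))) ?tV ?subrr ?mulr0//.
  by apply/funext => y; ring.
rewrite hf// -/m mulrC ltr_pdivlMr//.
have h1 : t * m <= 2 * q ^+ 2 / S * e.
  rewrite [leRHS]mulrAC ler_pdivlMr//.
  have h0 : t * m * S <= `|t| * `|m| * S.
    by rewrite ler_wpM2r ?(ltW S0)// -normrM ler_norm.
  have h2 := ler_wpM2l (normr_ge0 t) me.
  have h3 : `|t| * S * (e * q) <= 2 * (e * q) * (e * q).
    by rewrite ler_wpM2r// mulr_ge0// ltW.
  have h4 : 2 * (e * q) * (e * q) <= 2 * q ^+ 2 * e.
    have -> : 2 * (e * q) * (e * q) = 2 * q ^+ 2 * e * e by ring.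
    by rewrite ler_piMr// mulr_ge0 ?(ltW e0)// mulr_ge0 ?sqr_ge0.
  have h5 := ler_wpM2r (ltW S0) h2.
  lra.
have h6 : e * (S + 2 * q ^+ 2 / S) <= b.
  apply: le_trans (ler_wpM2l (ltW e0) nS) _.
  by rewrite mulrA ler_piMl// ltW.
nra.
Qed.

End Weight.

(** * A bump with a convex edge *)

Section Bump.
Variable R : realType.

Definition bump (x : R) : R := Num.max 0 (1 - x ^+ 2) ^+ 2.

(** The tangent to [bump] at [x] stays below its graph up to a loss [e * bump x],
    uniformly for short steps: in the interior the second-order error is
    absorbed by the loss, and near the edge [bump] is convex. The square in
    [bump] makes it differentiable across the edge, where no loss can be
    afforded. *)
Lemma bump_tangent (e : R) : 0 < e <= 1 ->
  exists2 r, 0 < r & forall x t, `|t| <= r ->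
    (1 - e) * bump x + t * (4 * x * Num.max 0 (1 - x ^+ 2)) <= bump (x - t).
Proof.
move=> /andP[e0 e1]; exists (e / 4); first by rewrite divr_gt0.
move=> x t; rewrite ler_norml => /andP[tl tu]; rewrite /bump.
have t2 : 16 * t ^+ 2 <= e ^+ 2 by nra.
have t2' : 16 * t ^+ 2 <= e by nra.
have [x1|x1] := leP (1 - x ^+ 2) 0.
  by rewrite expr0n/= !mulr0 addr0 sqr_ge0.
set T := 1 - x ^+ 2 in x1 *.
have xT : x ^+ 2 = 1 - T by rewrite /T; ring.
have -> : 1 - (x - t) ^+ 2 = T + 2 * (x * t) - t ^+ 2 by rewrite /T; ring.
have w2 : (x * t) ^+ 2 = (1 - T) * t ^+ 2 by rewrite exprMn xT.
have -> : t * (4 * x * T) = 4 * (x * t) * T by ring.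
have tt := sqr_ge0 t.
have T1 : T <= 1 by rewrite /T gerBl sqr_ge0.
move: (x * t) (t ^+ 2) w2 tt t2 t2' => w v w2 v0 v2 v2'.
(* [T] is the height at [x] before squaring, [w = x * t] and [v = t ^+ 2]; at
   [x - t] that height is [T + 2 * w - v], and [2 * v <= e * T] defines the interior *)
have [s0|s0] := leP 0 (T + 2 * w - v).
  have [Tv|Tv] := leP (2 * v) (e * T).
    have := sqr_ge0 (2 * w - v); nra.
  have T2 : T <= 1 / 8 by nra.
  suff : 2 * T * v <= (2 * w - v) ^+ 2 by nra.
  have : 4 * w * v <= w ^+ 2 + 4 * v ^+ 2 by have := sqr_ge0 (w - 2 * v); nra.
  nra.
rewrite expr0n/=.
have [Tv|Tv] := leP (2 * v) (e * T); first nra.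
have T2 : T <= 1 / 8 by nra.
have wv : 2 * w <= - v.
  rewrite leNgt; apply/negP => h.
  have h1 : (2 * w) ^+ 2 < v ^+ 2.
    have : 0 < (v - 2 * w) * (v + 2 * w) by rewrite mulr_gt0//; lra.
    nra.
  nra.
nra.
Qed.
End Bump.

(** * Comparison with a growing subsolution *)

Section Subsolution.
Variables (R : realType) (k h : R -> R) (c l0 a n : R).
Hypothesis hk : admissible_kernel k.
Hypothesis th : tame h.
Hypothesis h0 : forall y, 0 <= h y <= 1.
Hypothesis hn : forall y, n < `|y + c| -> h y = 0.
Hypothesis n0 : 0 < n.
Hypothesis a0 : 0 < a.
Hypothesis mean0 :
  kint k (fun y => h y * ((y + c) * expR (- l0 * (y + c)))) = 0.
Hypothesis mass1 : 1 < a * kint k (fun y => h y * expR (- l0 * (y + c))).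

Definition tilted_bump (L x : R) := expR (l0 * x) * bump (x / L).

Lemma continuous_tilted_bump L : continuous (tilted_bump L).
Proof.
have tb : tame (fun x => expR (l0 * x) * Num.max 0 (1 - (x * L^-1) ^+ 2) ^+ 2).
  have t1 : tame (fun x : R => x * L^-1).
    have -> : (fun x : R => x * L^-1) = (fun x => (x + 0) * L^-1).
      by apply/funext => x; rewrite addr0.
    by tame.
  have t2 : tame (fun x : R => Num.max 0 (1 - (x * L^-1) ^+ 2)).
    by apply: tame_pos_part; apply: tameB; [tame|apply: tameX].
  by apply: tameM; [tame|apply: tameX].
exact: tb.1.
Qed.

(** Undoing the tilt turns the weighted kernel into a centred measure of mass
    larger than [1]. Integrated against it, the tangent inequality of [bump] at
    a scale [L] much larger than the support of the weight loses its
    first-order term, so the mass survives up to the factor [1 - e]. *)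
Lemma tilted_bump_subsolution : exists L p, [/\ 0 < L, 1 < p &
  forall x, p * tilted_bump L x <=
    kint k (fun y => a * h y * tilted_bump L (x - (y + c)))].
Proof.
pose B := a * kint k (fun y => h y * expR (- l0 * (y + c))).
have B1 : 1 < B := mass1.
have [e /andP[e0 e1] eB] : exists2 e, 0 < e <= 1 & 1 < (1 - e) * B.
  move: B B1 => B B1; exists ((B - 1) / (2 * B)).
    by rewrite divr_gt0 ?ler_pdivrMr ?mulr_gt0 ?subr_gt0//; lra.
  have -> : (1 - (B - 1) / (2 * B)) * B = (B + 1) / 2 by field; lra.
  lra.
have [r r0 br] := @bump_tangent R e (introT andP (conj e0 e1)).
pose L := n / r; have L0 : 0 < L by rewrite divr_gt0.
exists L, ((1 - e) * B); split => // x; set E := fun y => expR (- l0 * (y + c)).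
have tE : tame E by rewrite /E; tame.
pose D := 4 * (x / L) * Num.max 0 (1 - (x / L) ^+ 2).
have tb : tame (fun y => a * h y * tilted_bump L (x - (y + c))).
  have t3 : tame (fun y => Num.max 0 (1 - ((x - (y + c)) / L) ^+ 2)).
    by apply: tame_pos_part; tame.
  have t4 : tame (fun y => expR (l0 * (x - (y + c)))).
    have -> : (fun y => expR (l0 * (x - (y + c)))) =
              (fun y => expR (l0 * x) * expR (- l0 * (y + c))).
      by apply/funext => y; rewrite -expRD; congr expR; ring.
    by tame.
  apply: tameM; first by tame.
  by apply: tameM => //; apply: tameX.
have -> : (1 - e) * B * tilted_bump L x =
   kint k (fun y => a * (expR (l0 * x) * ((1 - e) * bump (x / L))) * (h y * E y)
     + a * (expR (l0 * x) * (D / L)) * (h y * ((y + c) * E y))).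
  rewrite (kintD hk); try by tame.
  rewrite (kintZ hk); last by tame.
  rewrite (kintZ hk); last by tame.
  by rewrite mean0 mulr0 addr0 /B /tilted_bump; ring.
apply: (le_kint hk); [by tame|by []|] => y.
have [yn|yn] := ltP n `|y + c|.
  by rewrite (hn yn) !(mul0r, mulr0) addr0.
have -> : tilted_bump L (x - (y + c)) =
    expR (l0 * x) * E y * bump (x / L - (y + c) / L).
  rewrite /tilted_bump /E -expRD mulrBl; congr (expR _ * _); ring.
have zr : `|(y + c) / L| <= r.
  rewrite normrM normfV (gtr0_norm L0) ler_pdivrMr// /L.
  by rewrite mulrCA divff ?mulr1// gt_eqF.
have := br (x / L) _ zr; rewrite -/D => hb.
have w0 : 0 <= a * h y * (expR (l0 * x) * E y).
  have /andP[hy _] := h0 y.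
  by rewrite mulr_ge0 ?mulr_ge0 ?expR_ge0// ltW.
rewrite [leRHS]mulrA; have := ler_wpM2l w0 hb; apply: le_trans.
by rewrite le_eqVlt; apply/orP; left; apply/eqP; rewrite /D; ring.
Qed.

Lemma tilted_bump0 L : tilted_bump L 0 = 1.
Proof. by rewrite /tilted_bump /bump mulr0 expR0 mul0r expr0n/= subr0 max_r// expr1n mul1r. Qed.

Lemma tilted_bump_ge0 L x : 0 <= tilted_bump L x.
Proof. by rewrite /tilted_bump mulr_ge0 ?expR_ge0// sqr_ge0. Qed.

Lemma tilted_bump_out L x : 0 < L -> L < `|x| -> tilted_bump L x = 0.
Proof.
move=> L0 Lx; rewrite /tilted_bump /bump max_l ?expr0n/= ?mulr0// subr_le0.
rewrite -real_normK ?num_real// normrM normfV (gtr0_norm L0).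
have w1 : 1 <= `|x| / L by rewrite ler_pdivlMr// mul1r ltW.
by rewrite expr2 mulr_ege1.
Qed.

(** A positive supersolution dominates a small multiple of the bump, hence
    [p ^+ j] times that multiple for every [j], as the subsolution grows by the
    factor [p] at each application of the operator. As the
    supersolution property holds on a half-line, the bump is translated so that
    it vanishes outside of it. *)
Lemma no_positive_supersolution (u : R -> R) (Y : R) :
  continuous u -> (forall x, 0 < u x) ->
  (forall x, tame (fun y => u (x - (y + c)))) ->
  (forall x, x <= Y -> kint k (fun y => a * h y * u (x - (y + c))) <= u x) ->
  False.
Proof.
move=> cu u0 tu super.
have [L [p [L0 p1 sub]]] := tilted_bump_subsolution.
pose x0 := Y - L; pose f x := tilted_bump L (x - x0).
have cf : continuous f.
  move=> x; apply: (@continuous_comp _ _ _ (fun x => x - x0) (tilted_bump L)).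
    by apply: cvgB; [exact: cvg_id|exact: cvg_cst].
  exact: continuous_tilted_bump.
have f0 x : 0 <= f x by exact: tilted_bump_ge0.
have fout x : Y < x \/ x < x0 - L -> f x = 0.
  move=> xY; apply: tilted_bump_out => //; rewrite /x0 in xY *.
  by rewrite ltr_normr; apply/orP; case: xY => ?; [left|right]; lra.
have LL : x0 - L <= Y by rewrite /x0; lra.
have [xm _ um] := EVT_min LL (continuous_subspaceT cu).
have [xM _ fM] := EVT_max LL (continuous_subspaceT cf).
have [e e0 base] : exists2 e, 0 < e & forall x, e * f x <= u x.
  exists (u xm / (f xM + 1)); first by rewrite divr_gt0// ltr_wpDl.
  move=> x; have [xY|xY] := leP x Y; last first.
    by rewrite (fout x (or_introl xY)) mulr0; exact: ltW.
  have [xl|xl] := leP (x0 - L) x; last first.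
    by rewrite (fout x (or_intror xl)) mulr0; exact: ltW.
  have xi : x \in `[x0 - L, Y] by rewrite in_itv/= xl.
  apply: le_trans (um x xi); rewrite -mulrA ler_piMr ?(ltW (u0 _))//.
  by rewrite ler_pdivrMl ?mulr1 ?ltr_wpDl//; have := fM x xi; lra.
have grow j : forall x, e * p ^+ j * f x <= u x.
  elim: j => [|j IH] x; first by rewrite expr0 mulr1.
  have [xY|xY] := leP x Y; last by rewrite (fout x (or_introl xY)) mulr0; exact: ltW.
  apply: le_trans (super x xY).
  have ep0 : 0 <= e * p ^+ j by rewrite mulr_ge0 ?exprn_ge0// ltW// (lt_trans ltr01).
  have tf : tame (fun y => f (x - (y + c))).
    apply: (@tame_bounded _ _ (f xM)).
      move=> y; apply: (@continuous_comp _ _ _ (fun y => x - (y + c)) f).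
        apply: cvgB; first exact: cvg_cst.
        by apply: cvgD; [exact: cvg_id|exact: cvg_cst].
      exact: cf.
    move=> y; rewrite ger0_norm//; set w := x - _.
    have fM0 : 0 <= f xM by [].
    have [xY'|xY'] := leP w Y; last by rewrite (fout w (or_introl xY')).
    have [xl|xl] := leP (x0 - L) w; last by rewrite (fout w (or_intror xl)).
    by apply: fM; rewrite in_itv/= xl.
  have tux := tu x.
  apply: (@le_trans _ _ (kint k (fun y => e * p ^+ j * (a * h y * f (x - (y + c)))))).
    rewrite (kintZ hk); last by tame.
    rewrite exprSr mulrA -mulrA ler_wpM2l//.
    apply: le_trans (sub (x - x0)) _; rewrite le_eqVlt; apply/orP; left; apply/eqP.
    by congr kint; apply/funext => y; rewrite /f; congr (_ * tilted_bump L _); ring.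
  apply: (le_kint hk); try by tame.
  move=> y; have /andP[hy _] := h0 y.
  rewrite mulrCA ler_wpM2l// mulr_ge0// ltW//.
have bern j : 1 + (p - 1) * j%:R <= p ^+ j.
  elim: j => [|j IH]; first by rewrite mulr0 addr0 expr0.
  have j0 : 0 <= j%:R :> R by [].
  have := ler_wpM2l (ltW (lt_trans ltr01 p1)) IH.
  have := mulr_ge0 (sqr_ge0 (p - 1)) j0.
  by rewrite [p ^+ j.+1]exprS -natr1; lra.
have ub j : e * (1 + (p - 1) * j%:R) <= u x0.
  apply: le_trans (grow j x0); rewrite /f subrr tilted_bump0 mulr1.
  by rewrite ler_wpM2l// ltW.
have ep : 0 < e * (p - 1) by rewrite mulr_gt0// subr_gt0.
have := archi_boundP (divr_ge0 (ltW (u0 x0)) (ltW ep)).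
rewrite ltr_pdivrMr// => big.
have := ub (Num.bound (u x0 / (e * (p - 1)))); lra.
Qed.

End Subsolution.

(** * The wave system *)

Section Wave.
Variables (R : realType).

Lemma unif_continuousW (u : R -> R) : unif_continuous u -> continuous u.
Proof.
move=> /unif_continuousP cu x; apply/cvgrPdist_lt => e e0.
have [r r0 ur] := cu e e0; near=> y.
have xy : ball x r y by near: y; apply/nbhs_ballP; exists r.
exact: (ur (x, y) xy).
Unshelve. all: by end_near. Qed.

Lemma continuous_reflect (u : R -> R) (x : R) : continuous u ->
  continuous (fun y => u (x - y)).
Proof.
move=> cu y; apply: (@continuous_comp _ _ _ (fun y => x - y) u); last exact: cu.
by apply: cvgB; [exact: cvg_cst|exact: cvg_id].
Qed.

Lemma bounded_fun_norm (u : R -> R) : bounded_fun u -> exists M, forall x, `|u x| <= M.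
Proof.
move=> [M [_ hM]]; exists (M + 1) => x.
by apply: (hM (M + 1)); rewrite ?ltrDl.
Qed.

(** Near [-oo] the denominator is at most [(1 + d) * g],
    where the tilted mass [laplace k c l0] exceeds [g > (1 + d)^-1], so [u] is a
    supersolution of the linear problem with the centred weight multiplied by
    [g^-1], whose mass is larger than [1]. *)
Lemma slow_wave_absurd (k u v : R -> R) (a b c d : R) :
  0 <= a -> 0 <= b -> 0 < d -> admissible_kernel k ->
  0 < c -> c < linear_speed d k ->
  bounded_unif_continuous u -> bounded_unif_continuous v ->
  (forall x, 0 < u x) -> (forall x, 0 < v x) ->
  wave_equation c d b a k u v ->
  u x @[x --> -oo] --> (0 : R) -> v x @[x --> -oo] --> (0 : R) -> False.
Proof.
move=> a0 b0 d0 hk c0 cs [bu /unif_continuousW cu] [bv /unif_continuousW cv].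
move=> u0 v0 wave u_lim v_lim.
have hs := linear_speed_growth c0 cs.
have [l0 [minl0 m1 grow]] := laplace_minimizer hk d0 c0 cs hs.
have d1 : 0 < 1 + d by rewrite addr_gt0.
have m0 : (1 + d)^-1 < laplace k c l0 by rewrite -[X in X < _]mulr1 ltr_pdivrMl.
pose g := ((1 + d)^-1 + laplace k c l0) / 2.
have g1 : (1 + d)^-1 < g by rewrite /g; lra.
have gl : g < laplace k c l0 by rewrite /g; lra.
have g0 : 0 < g by apply: lt_trans g1; rewrite invr_gt0.
have [n [h [n0 th h01 hn [hm hM]]]] := centered_weight hk
  (tame_expR_shift (- l0) c) (fun y => expR_ge0 _) (tilted_mean0 hk minl0)
  (tilted_variance_gt0 hk grow) (ltW g0) gl.
have dg : 1 < (1 + d) * g by rewrite -ltr_pdivrMl// mulr1.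
have [X small] : exists X, forall x, x <= X ->
    d * (u x + b * u (x - c) + a * v x) <= (1 + d) * g - 1.
  pose e := ((1 + d) * g - 1) / (d * (1 + b + a)).
  have dd : 0 < d * (1 + b + a) by rewrite mulr_gt0//; lra.
  have e0 : 0 < e by rewrite divr_gt0// subr_gt0.
  have [X1 [_ h1]] : \forall x \near -oo, u x < e.
    exact: (cvgr_lt _ u_lim).
  have [X2 [_ h2]] : \forall x \near -oo, v x < e.
    exact: (cvgr_lt _ v_lim).
  exists (Num.min X1 X2 - 1) => x xX.
  have xX1 : x < X1.
    by apply: le_lt_trans xX _; rewrite ltrBlDr; apply: (@le_lt_trans _ _ X1); rewrite ?ge_min ?lexx ?ltrDl.
  have xX2 : x < X2.
    by apply: le_lt_trans xX _; rewrite ltrBlDr; apply: (@le_lt_trans _ _ X2); rewrite ?ge_min ?lexx ?orbT ?ltrDl.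
  have ed : e * (d * (1 + b + a)) = (1 + d) * g - 1 by rewrite divfK// gt_eqF.
  have q1 : u x <= e := ltW (h1 _ xX1).
  have q2 : b * u (x - c) <= b * e.
    by rewrite ler_wpM2l//; apply/ltW/h1; lra.
  have q3 : a * v x <= a * e by rewrite ler_wpM2l//; exact/ltW/h2.
  rewrite -ed mulrCA ler_wpM2l ?(ltW d0)//; lra.
pose den x := 1 + d * (u x + b * u (x - c) + a * v x).
have den1 x : 1 <= den x.
  rewrite /den lerDl mulr_ge0 ?(ltW d0)// addr_ge0 ?addr_ge0 ?mulr_ge0//; exact: ltW.
have cden : continuous den.
  move=> x; apply: cvgD; first exact: cvg_cst.
  apply: cvgM; first exact: cvg_cst.
  apply: cvgD; last by apply: cvgM; [exact: cvg_cst|exact: cv].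
  apply: cvgD; first exact: cu.
  apply: cvgM; first exact: cvg_cst.
  apply: (@continuous_comp _ _ _ (fun x => x - c) u); last exact: cu.
  by apply: cvgB; [exact: cvg_id|exact: cvg_cst].
have [M uM] := bounded_fun_norm bu.
have tF x : tame (fun y => (1 + d) * u (x - y) / den (x - y)).
  apply: (@tame_bounded _ _ ((1 + d) * M)).
    apply: (continuous_reflect (u := fun z => (1 + d) * u z / den z)) => z.
    apply: cvgM; first by apply: cvgM; [exact: cvg_cst|exact: cu].
    by apply: cvgV; [rewrite gt_eqF// (lt_le_trans ltr01)|exact: cden].
  move=> y; have D1 := den1 (x - y); have D0 := lt_le_trans ltr01 D1.
  rewrite normrM normfV (gtr0_norm D0) ler_pdivrMr// normrM (gtr0_norm d1).
  rewrite -mulrA ler_pM2l//; apply: le_trans (uM _) _.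
  by rewrite ler_peMr// (le_trans (normr_ge0 _) (uM x)).
apply: (@no_positive_supersolution R k h c l0 g^-1 n hk th h01 hn n0 _ hm _ u (X - n)) => //.
- by rewrite invr_gt0.
- by rewrite ltr_pdivlMl ?mulr1.
- move=> x; apply: (@tame_bounded _ _ M) => // y.
  apply: (@continuous_comp _ _ _ (fun y => y + c) (fun z => u (x - z))).
    by apply: cvgD; [exact: cvg_id|exact: cvg_cst].
  exact: continuous_reflect.
- move=> x xX; rewrite -{2}(subrK c x) wave.
  have tu : tame (fun y => u (x - (y + c))).
    apply: (@tame_bounded _ _ M) => // y.
    apply: (@continuous_comp _ _ _ (fun y => y + c) (fun z => u (x - z))).
      by apply: cvgD; [exact: cvg_id|exact: cvg_cst].
    exact: continuous_reflect.
  apply: (le_kint hk); [by tame|exact: tF|] => y.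
  have -> : x - c - y = x - (y + c) by ring.
  set z := x - (y + c); rewrite -/(den z).
  have dz := lt_le_trans ltr01 (den1 z).
  have [yn|yn] := ltP n `|y + c|.
    by rewrite (hn _ yn) mulr0 mul0r divr_ge0 ?mulr_ge0 ?ltW.
  have zX : z <= X.
    by move: yn; rewrite ler_norml /z => /andP[? ?]; lra.
  have denz : den z <= (1 + d) * g by have := small z zX; rewrite /den; lra.
  have /andP[hy0 hy1] := h01 y.
  rewrite ler_pdivlMr// -!mulrA.
  apply: (@le_trans _ _ (g^-1 * (h y * (u z * ((1 + d) * g))))).
    by rewrite ler_pM2l ?invr_gt0// ler_wpM2l// ler_pM2l.
  have -> : g^-1 * (h y * (u z * ((1 + d) * g))) = h y * ((1 + d) * u z).
    by field; rewrite gt_eqF.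
  by rewrite ler_piMl// mulr_ge0// ltW.
Qed.
End Wave.

Theorem theorem5p12 (R : realType) (a1 a2 b1 b2 d1 d2 : R) (k1 k2 : R -> R)
  (c : R)
  (ha1 : 0 <= a1) (ha2 : 0 <= a2) (hb1 : 0 <= b1) (hb2 : 0 <= b2)
  (hd1 : 0 < d1) (hd2 : 0 < d2)
  (ha2b1 : a2 < 1 + b1) (ha1b2 : a1 < 1 + b2)
  (hk1 : admissible_kernel k1) (hk2 : admissible_kernel k2)
  (hc : 0 < c) (hcstar : c < cstar d1 d2 k1 k2) :
  ~ exists rho vrho : R -> R,
      [/\ bounded_unif_continuous rho /\ bounded_unif_continuous vrho,
          (forall xi : R, 0 < rho xi) /\ (forall xi : R, 0 < vrho xi),
          wave_equation c d1 b1 a1 k1 rho vrho /\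
            wave_equation c d2 b2 a2 k2 vrho rho,
          (rho xi @[xi --> -oo%R] --> (0 : R)) /\
            (vrho xi @[xi --> -oo%R] --> (0 : R)) &
          (0 < limf_einf (EFin \o rho) (+oo%R : set_system R))%E /\
            (0 < limf_einf (EFin \o vrho) (+oo%R : set_system R))%E].
Proof.
move=> [u [v [[bu bv] [u0 v0] [wu wv] [lu lv] _]]].
move: hcstar; rewrite /cstar lt_max => /orP[cs|cs].
  exact: (slow_wave_absurd ha1 hb1 hd1 hk1 hc cs bu bv u0 v0 wu lu lv).
exact: (slow_wave_absurd ha2 hb2 hd2 hk2 hc cs bv bu v0 u0 wv lv lu).
Qed.
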